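(* Let $(a_n)_{n\in\mathbb{N}}$ be a sequence of positive integers satisfying the large gap condition $\frac{a_{n+1}}{a_n}\to\infty$ as $n\to\infty$. Let $f(x)=\sum_{d=-D}^{D}c_d e^{2\pi i d x}$ be a trigonometric polynomial with $D\in\mathbb{N}$, $c_d\in\mathbb{R}$, $c_d=c_{-d}$ for all $d$, $c_0=0$, and $\sum_{d=-D}^D c_d^2>0$. Let $U$ be uniformly distributed on $[0,1]$, $X_j=f(a_jU)$, and $S_n^f=\sum_{j=1}^n X_j$. Let $(z_n)_{n\in\mathbb{N}}$ be a sequence of positive numbers converging to $0$ such that $z_n n\to\infty$ as $n\to\infty$. Put $x_n=n z_n\,\mathbb{E}X_1^2$ and $y_n=n\sqrt{z_n}\,\mathbb{E}X_1^2$. Then $\mathbb{E}(S_n^f)^2=n\,\mathbb{E}X_1^2+O(1)$ as $n\to\infty$, and $\left(\frac{S_n^f}{y_n}\right)_{n\in\mathbb{N}}$ satisfies a moderate deviation principle with speed $x_n$ and good rate function $I(t)=\frac{t^2}{2}$.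
   Context: A sequence $(Z_n)_{n\in\mathbb{N}}$ of real random variables satisfies a large deviation principle with speed $x_n$ and good rate function $I:\mathbb{R}\to[0,\infty]$ if and only if $x_n>0$, $\lim_{n\to\infty}x_n=\infty$, all sublevel sets of $I$ are compact, and for every Borel set $B\subseteq\mathbb{R}$, $$-\inf_{t\in\operatorname{int}B}I(t)\le\liminf_{n\to\infty}\frac1{x_n}\log\mathbb{P}(Z_n\in B)\le\limsup_{n\to\infty}\frac1{x_n}\log\mathbb{P}(Z_n\in B)\le-\inf_{t\in\overline{B}}I(t),$$ where $\operatorname{int}B$ is the interior and $\overline B$ the closure of $B$. When $Z_n=S_n/y_n$ with $S_n$ a sum of $n$ random variables and $y_n\to\infty$ slower than $n$ but faster than $\sqrt n$, one says ''moderate deviation principle'' for the very same property. *)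

(* Defs.v *)
From HB Require Import structures.
From mathcomp Require Import all_boot all_order all_algebra.
From mathcomp Require Import all_classical all_reals all_analysis.
From mathcomp Require Import complex.
Set Implicit Arguments.
Unset Strict Implicit.
Unset Printing Implicit Defensive.
Import Order.TTheory GRing.Theory Num.Theory.
Import numFieldNormedType.Exports.
Local Open Scope classical_set_scope.
Local Open Scope ring_scope.

(* Sequences are indexed by n >= 1: they are functions on nat whose value at 0
   is never used. *)

Definition symm_range (D : nat) : seq int :=
  [seq k%:Z - D%:Z | k <- iota 0 D.*2.+1].

Definition expi (R : realType) (t : R) : R[i] := (cos t +i* sin t)%C.

Definition trig_poly (R : realType) (D : nat) (c : int -> R) (x : R) : R[i] :=
  \sum_(d <- symm_range D) ((c d)%:C)%C * expi (2 * pi * d%:~R * x).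

Definition partial_sum (R : realType) (T : Type) (X : nat -> T -> R)
    (n : nat) (w : T) : R :=
  \sum_(1 <= j < n.+1) X j w.

(* The sublevel sets are those at finite levels.  The logarithm lne is
   extended-real valued with lne 0 = -oo, and the infimum over the empty set
   is +oo. *)
Definition large_deviation_principle (d : measure_display)
    (T : measurableType d) (R : realType) (P : probability T R)
    (Z : nat -> T -> R) (x : nat -> R) (I : R -> \bar R) : Prop :=
  [/\ forall n : nat, (0 < n)%N -> measurable_fun setT (Z n),
      forall n : nat, (0 < n)%N -> 0 < x n,
      x n @[n --> \oo] --> +oo,
      (forall t : R, (0 <= I t)%E) /\
      (forall r : R, compact [set t | (I t <= r%:E)%E]) &
      forall B : set R, measurable B ->
        let u (n : nat) : \bar R :=
          (((x n)^-1)%:E * lne (P (Z n @^-1` B)))%E in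
        [/\ (- ereal_inf (I @` interior B) <= limn_einf u)%E,
            (limn_einf u <= limn_esup u)%E &
            (limn_esup u <= - ereal_inf (I @` closure B))%E]].

(* The deviation principle for S_n / y_n together with the scale conditions
   that make it moderate: y_n tends to infinity, slower than n and faster than
   sqrt n. *)
Definition moderate_deviation_principle (d : measure_display)
    (T : measurableType d) (R : realType) (P : probability T R)
    (X : nat -> T -> R) (y x : nat -> R) (I : R -> \bar R) : Prop :=
  [/\ y n @[n --> \oo] --> +oo,
      y n / n%:R @[n --> \oo] --> 0,
      y n / Num.sqrt n%:R @[n --> \oo] --> +oo &
      large_deviation_principle P (fun n w => partial_sum X n w / y n) x I].

(* Main.v *)
Require Import Defs.
From HB Require Import structures.
From mathcomp Require Import all_boot all_order all_algebra.
From mathcomp Require Import all_classical all_reals all_analysis.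
From mathcomp Require Import measurable_realfun complex.
From mathcomp Require Import ring lra zify.
Set Implicit Arguments.
Unset Strict Implicit.
Unset Printing Implicit Defensive.
Import Order.TTheory GRing.Theory Num.Theory.
Import numFieldNormedType.Exports.
Local Open Scope classical_set_scope.
Local Open Scope ring_scope.

(** Since the gaps tend to infinity, from some index on every frequency of a
    trigonometric polynomial in [a_1 U, ..., a_n U] of bounded degree is smaller
    than [a_(n+1)]; multiplying by a polynomial in [a_(n+1) U] then multiplies
    the means.  Hence [E S_n^2] grows by exactly [E X_1^2] at each further step.
    For the exponential moments, [exp (lam X_j)] is, up to a factor
    [exp (O(lam^3))], the trigonometric polynomial
    [1 + lam X_j + lam^2 X_j^2 / 2], so that [E exp (lam S_n)] is
    [(1 + lam^2 E X_1^2 / 2)^n] up to [exp (O(1) + n O(lam^3))].  With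
    [lam = t sqrt z_n] this error is [exp (o(x_n))]; an expansion to first order
    only would not be enough.  A Gaertner-Ellis argument for the Gaussian limit
    [t^2 / 2] concludes. *)

Section BoundedRandomVariables.
Context (d : measure_display) (T : measurableType d) (R : realType)
  (P : probability T R).
Implicit Types X Y : T -> R.

Definition bounded_rv X : Prop :=
  measurable_fun setT X /\ exists M, forall w, `|X w| <= M.

Definition mean X : R := fine ('E_P[X])%E.

Lemma bounded_rv_cst r : bounded_rv (fun=> r).
Proof. by split; [exact: measurable_cst|exists `|r|]. Qed.

Lemma bounded_rvD X Y :
  bounded_rv X -> bounded_rv Y -> bounded_rv (fun w => X w + Y w).
Proof.
move=> [mX [M XM]] [mY [N YN]]; split; first exact: measurable_funD.
by exists (M + N) => w; rewrite (le_trans (ler_normD _ _))// lerD.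
Qed.

Lemma bounded_rvM X Y :
  bounded_rv X -> bounded_rv Y -> bounded_rv (fun w => X w * Y w).
Proof.
move=> [mX [M XM]] [mY [N YN]]; split; first exact: measurable_funM.
by exists (M * N) => w; rewrite normrM ler_pM.
Qed.

Lemma bounded_rvZ r X : bounded_rv X -> bounded_rv (fun w => r * X w).
Proof. by move=> bX; apply: bounded_rvM => //; exact: bounded_rv_cst. Qed.

Lemma bounded_rv_sum I (s : seq I) (Q : pred I) (F : I -> T -> R) :
  (forall i, Q i -> bounded_rv (F i)) ->
  bounded_rv (fun w => \sum_(i <- s | Q i) F i w).
Proof.
move=> bF; elim: s => [|i s IH].
  rewrite (_ : (fun w => _) = fun=> 0); first exact: bounded_rv_cst.
  by apply/funext => w; rewrite big_nil.
have [Qi|nQi] := boolP (Q i).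
  rewrite (_ : (fun w => _) = (fun w => F i w + \sum_(j <- s | Q j) F j w)).
    by apply: bounded_rvD => //; exact: bF.
  by apply/funext => w; rewrite big_cons Qi.
rewrite (_ : (fun w => _) = (fun w => \sum_(j <- s | Q j) F j w)) //.
by apply/funext => w; rewrite big_cons (negbTE nQi).
Qed.

Lemma bounded_rv_expR X : bounded_rv X -> bounded_rv (fun w => expR (X w)).
Proof.
move=> [mX [M XM]]; split; first exact: measurableT_comp.
exists (expR M) => w.
by rewrite ger0_norm ?expR_ge0// ler_expR (le_trans (ler_norm _)).
Qed.

Lemma bounded_rv_indic (A : set T) : measurable A -> bounded_rv \1_A.
Proof.
move=> mA; split; first exact: measurable_indic.
by exists 1 => w; rewrite indicE; case: (_ \in _); rewrite ?normr1 ?normr0.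
Qed.

Lemma bounded_rv_integrable X :
  bounded_rv X -> P.-integrable setT (EFin \o X).
Proof.
move=> [mX [M XM]]; apply: measurable_bounded_integrable => //.
  by rewrite (le_lt_trans (probability_le1 P measurableT)) ?ltry.
by exists M; split; [exact: num_real|move=> N /ltW MN w _ /=; exact: le_trans (XM w) MN].
Qed.

Lemma meanD X Y : bounded_rv X -> bounded_rv Y ->
  mean (fun w => X w + Y w) = mean X + mean Y.
Proof.
move=> bX bY; rewrite /mean unlock.
exact: (RintegralD measurableT (bounded_rv_integrable bX) (bounded_rv_integrable bY)).
Qed.

Lemma meanZ r X : bounded_rv X -> mean (fun w => r * X w) = r * mean X.
Proof.
move=> bX; rewrite /mean unlock.
exact: (RintegralZl r measurableT (bounded_rv_integrable bX)).
Qed.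

Lemma mean_cst r : mean (fun=> r) = r.
Proof. by rewrite /mean (expectation_cst P r). Qed.

Lemma mean_sum (I : eqType) (s : seq I) (F : I -> T -> R) :
  (forall i, bounded_rv (F i)) ->
  mean (fun w => \sum_(i <- s) F i w) = \sum_(i <- s) mean (F i).
Proof.
move=> bF; elim: s => [|i s IH].
  rewrite big_nil -[RHS](mean_cst 0); congr mean.
  by apply/funext => w; rewrite big_nil.
rewrite big_cons -IH -meanD; last 2 first.
- exact: bF.
- by apply: bounded_rv_sum.
by congr mean; apply/funext => w; rewrite big_cons.
Qed.

Lemma mean_le X Y : bounded_rv X -> bounded_rv Y ->
  (forall w, X w <= Y w) -> mean X <= mean Y.
Proof.
move=> bX bY XY; rewrite /mean unlock.
apply: (le_Rintegral measurableT (bounded_rv_integrable bX) (bounded_rv_integrable bY)).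
by move=> w _; exact: XY.
Qed.

Lemma mean_indic (A : set T) : measurable A -> mean \1_A = fine (P A).
Proof. by move=> mA; rewrite /mean expectation_indic. Qed.

End BoundedRandomVariables.

Section LimSup.
Context {R : realType}.
Implicit Types (u : (\bar R)^nat) (l : \bar R).
Local Open Scope ereal_scope.

Lemma limn_esup_le_near u l : (\forall n \near \oo, u n <= l) ->
  limn_esup u <= l.
Proof.
move=> ul; rewrite /limn_esup limf_esupE; apply: ge_ereal_inf => /=.
exists (ereal_sup (u @` [set n | u n <= l])); first by exists [set n | u n <= l].
by apply: ge_ereal_sup => _ [n /= un <-].
Qed.

Lemma limn_einf_ge_near u l : (\forall n \near \oo, l <= u n) ->
  l <= limn_einf u.
Proof.
move=> lu; rewrite /limn_einf leeNr; apply: limn_esup_le_near.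
by apply: filterS lu => n; rewrite leeN2.
Qed.

Lemma scaled_lne_le (x p r : R) : (0 < x)%R -> (p <= expR (x * r))%R ->
  x^-1%:E * lne p%:E <= r%:E.
Proof.
move=> x0 pr; have [p0|p0] := leP p 0%R.
  by rewrite le0_lneNy ?lee_fin// gt0_muleNy ?lte_fin ?invr_gt0// leNye.
rewrite lne_EFin// -EFinM lee_fin ler_pdivrMl//.
by rewrite -ler_expR lnK.
Qed.

Lemma scaled_lne_ge (x p r : R) : (0 < x)%R -> (expR (x * r) <= p)%R ->
  r%:E <= x^-1%:E * lne p%:E.
Proof.
move=> x0 pr; have p0 : (0 < p)%R by exact: lt_le_trans (expR_gt0 _) pr.
by rewrite lne_EFin// -EFinM lee_fin ler_pdivlMl// -ler_expR lnK.
Qed.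

End LimSup.

Section GaussianTails.
Context (d : measure_display) (T : measurableType d) (R : realType)
  (P : probability T R).
Variables (X : T -> R) (x : R).
Hypotheses (bX : bounded_rv X) (x0 : 0 < x).

Let M (t : R) := mean P (fun w => expR (t * x * X w)).

Let bM t : bounded_rv (fun w => expR (t * x * X w)).
Proof. by apply: bounded_rv_expR; exact: bounded_rvZ. Qed.

Lemma gaussian_tail_le (t e : R) (A : set T) : measurable A -> 0 <= t ->
  (forall w, A w -> t <= `|X w|) ->
  M t <= expR (x * (t ^+ 2 / 2 + e)) ->
  M (- t) <= expR (x * (t ^+ 2 / 2 + e)) ->
  fine (P A) <= 2 * expR (x * (- (t ^+ 2 / 2) + e)).
Proof.
move=> mA t0 At Mt MNt; rewrite -mean_indic//.
have b := bounded_rvZ (expR (- (x * t ^+ 2))) (bounded_rvD (bM t) (bM (- t))).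
apply: (le_trans (mean_le P (bounded_rv_indic _ mA) b _)).
  move=> w; rewrite indicE; case: (boolP (w \in A)) => [|_]; last first.
    by rewrite mulr_ge0 ?addr_ge0 ?expR_ge0.
  rewrite inE => /At; rewrite mulrDr -!expRD ler_normr => /orP[tX|tX].
    rewrite ler_wpDr ?expR_ge0// -expR0 ler_expR.
    suff : 0 <= t * x * (X w - t) by lra.
    by rewrite !mulr_ge0 ?subr_ge0 ?(ltW x0).
  rewrite ler_wpDl ?expR_ge0// -expR0 ler_expR.
  suff : 0 <= t * x * (- X w - t) by lra.
  by rewrite !mulr_ge0 ?subr_ge0 ?(ltW x0).
rewrite meanZ; last exact: bounded_rvD.
rewrite meanD// -/(M t) -/(M (- t)).
apply: (@le_trans _ _ (expR (- (x * t ^+ 2)) * (2 * expR (x * (t ^+ 2 / 2 + e))))).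
  by rewrite ler_wpM2l ?expR_ge0//; lra.
by rewrite mulrCA -expRD ler_wpM2l// ler_expR; lra.
Qed.

(* [exp (t x X)] outside the ball around [t] is dominated by
   [exp ((t + e) x X)] on the right and [exp ((t - e) x X)] on the left, whose
   means are too small to make up for [M t]; no change of measure is needed. *)
Lemma gaussian_ball_ge (t e : R) (A : set T) : measurable A -> 0 < e ->
  (forall w, `|X w - t| < e -> A w) ->
  4 <= expR (x * (e ^+ 2 / 4)) ->
  expR (x * (t ^+ 2 / 2 - e ^+ 2 / 8)) <= M t ->
  M (t + e) <= expR (x * ((t + e) ^+ 2 / 2 + e ^+ 2 / 8)) ->
  M (t - e) <= expR (x * ((t - e) ^+ 2 / 2 + e ^+ 2 / 8)) ->
  expR (- (x * (t ^+ 2 / 2 + `|t| * e + e ^+ 2 / 8))) / 2 <= fine (P A).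
Proof.
move=> mA e0 At x4 Mt Mpe Mme; rewrite -mean_indic//.
set p := mean P \1_A.
set G := expR (x * (t ^+ 2 / 2 - e ^+ 2 / 8)) in Mt *.
set C := expR (x * (t ^+ 2 + `|t| * e)).
have C0 : 0 < C by exact: expR_gt0.
have bA := bounded_rvZ C (bounded_rv_indic R mA).
have bp := bounded_rvZ (expR (- (x * (e * (t + e))))) (bM (t + e)).
have bm := bounded_rvZ (expR (x * (e * (t - e)))) (bM (t - e)).
have split_mgf : M t <= C * p + (expR (- (x * (e * (t + e)))) * M (t + e) +
                                 expR (x * (e * (t - e))) * M (t - e)).
  rewrite -!meanZ//; last exact: bounded_rv_indic.
  rewrite -!meanD//; last exact: bounded_rvD.
  apply: mean_le => //; first by do 2?apply: bounded_rvD.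
  move=> w; have [tX|tX] := ltP `|X w - t| e.
    rewrite indicE mem_set ?mulr1; last exact: At.
    rewrite ler_wpDr ?addr_ge0 ?mulr_ge0 ?expR_ge0// ler_expR.
    have : t * (X w - t) <= `|t| * e.
      by rewrite (le_trans (ler_norm _))// normrM ler_wpM2l// ltW.
    by move=> /(ler_wpM2l (ltW x0)); lra.
  have : 0 <= C * \1_A w by rewrite mulr_ge0 ?(ltW C0)// indicE; case: (_ \in _).
  move=> CA0; rewrite ler_wpDl//.
  rewrite -!expRD; move: tX; rewrite ler_normr => /orP[tX|tX].
    rewrite ler_wpDr ?expR_ge0// ler_expR.
    suff : 0 <= x * (e * (X w - t - e)) by lra.
    by rewrite !mulr_ge0 ?subr_ge0 ?(ltW x0) ?(ltW e0).
  rewrite ler_wpDl ?expR_ge0// ler_expR.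
  suff : 0 <= x * (e * (- (X w - t) - e)) by lra.
  by rewrite !mulr_ge0 ?subr_ge0 ?(ltW x0) ?(ltW e0).
have tail b c : b + x * (c + e ^+ 2 / 8) = x * (t ^+ 2 / 2 - 3 * e ^+ 2 / 8) ->
    forall m, m <= expR (x * (c + e ^+ 2 / 8)) -> expR b * m <= G / 4.
  move=> bc m mle; apply: (@le_trans _ _ (expR (x * (t ^+ 2 / 2 - 3 * e ^+ 2 / 8)))).
    by rewrite -bc expRD ler_wpM2l ?expR_ge0.
  rewrite ler_pdivlMr// (le_trans (ler_wpM2l (expR_ge0 _) x4))//.
  by rewrite -expRD ler_expR; lra.
have := tail (- (x * (e * (t + e)))) ((t + e) ^+ 2 / 2) _ _ Mpe.
have := tail (x * (e * (t - e))) ((t - e) ^+ 2 / 2) _ _ Mme.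
move=> tm tp.
have {}tm := tm ltac:(by field); have {}tp := tp ltac:(by field).
have CG : C * expR (- (x * (t ^+ 2 / 2 + `|t| * e + e ^+ 2 / 8))) = G.
  by rewrite -expRD; congr expR; field.
rewrite -(ler_pM2l C0) mulrA CG; lra.
Qed.

End GaussianTails.

Section GaussianLargeDeviations.
Context (d : measure_display) (T : measurableType d) (R : realType)
  (P : probability T R).

Lemma gaussian_rate_compact (r : R) :
  compact [set t : R | ((t ^+ 2 / 2)%:E <= r%:E)%E].
Proof.
apply: (subclosed_compact (B := `[- Num.sqrt (2 * r), Num.sqrt (2 * r)]%classic)).
- rewrite (_ : [set t | _] = (fun t : R => t ^+ 2 / 2) @^-1` [set s | s <= r]).
    apply: preimage_closed; last exact: closed_le.
    by move=> t _; apply: cvgM; [exact: exprn_continuous|exact: cvg_cst].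
  by apply/seteqP; split => t /=; rewrite lee_fin.
- exact: segment_compact.
- move=> t /=; rewrite lee_fin in_itv/= -ler_norml => tr.
  by rewrite -sqrtr_sqr ler_wsqrtr//; lra.
Qed.

Lemma gaussian_gartner_ellis (Z : nat -> T -> R) (x : nat -> R) :
  (forall n, bounded_rv (Z n)) -> (forall n, (0 < n)%N -> 0 < x n) ->
  x n @[n --> \oo] --> +oo ->
  (forall t e : R, 0 < e -> \forall n \near \oo,
     expR (x n * (t ^+ 2 / 2 - e)) <= mean P (fun w => expR (t * x n * Z n w))
       <= expR (x n * (t ^+ 2 / 2 + e))) ->
  large_deviation_principle P Z x (fun t => (t ^+ 2 / 2)%:E).
Proof.
move=> bZ x0 xy mgf.
have x_ge (A : R) : \forall n \near \oo, A <= x n.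
  by move/cvgryPge : xy; exact.
split=> //.
- by move=> n _; have [] := bZ n.
- split; last exact: gaussian_rate_compact.
  by move=> t; rewrite lee_fin; have := sqr_ge0 t; lra.
move=> B mB u; have mZB n : measurable (Z n @^-1` B).
  by rewrite -[_ @^-1` _]setTI; apply: (proj1 (bZ n)).
have uE n : u n = ((x n)^-1%:E * lne (fine (P (Z n @^-1` B)))%:E)%E.
  by rewrite /u fineK// fin_num_measure.
split; [|exact: limn_einf_sup|].
- rewrite leeNl; apply: le_ereal_inf_tmp => _ [t tB <-].
  rewrite leeNl; apply/lee_subgt0Pr => eta eta0.
  move: tB => /nbhs_ballP[e0 /= e00 e0B].
  have t2 : 0 < `|t| + 2 by rewrite ltr_wpDl.
  pose e := Num.min e0 (Num.min 1 (eta / (`|t| + 2))).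
  have e_gt0 : 0 < e by rewrite !lt_min e00 ltr01 divr_gt0.
  have ee0 : e <= e0 by rewrite ge_min lexx.
  have e1 : e <= 1 by rewrite !ge_min lexx orbT.
  have eeta : (`|t| + 2) * e <= eta.
    by rewrite mulrC -ler_pdivlMr// !ge_min lexx !orbT.
  have e28 : 0 < e ^+ 2 / 8 by rewrite divr_gt0// exprn_gt0.
  apply: limn_einf_ge_near; near=> n.
  have n0 : (0 < n)%N by near: n; exists 1%N.
  rewrite uE -EFinD; apply: scaled_lne_ge; first exact: x0.
  have xe1 : 1 <= x n * e.
    by rewrite -ler_pdivrMr//; near: n; exact: x_ge.
  have xe4 : 4 <= x n * (e ^+ 2 / 4).
    by rewrite -ler_pdivrMr ?divr_gt0 ?exprn_gt0//; near: n; exact: x_ge.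
  have /andP[Mt _] : expR (x n * (t ^+ 2 / 2 - e ^+ 2 / 8)) <=
      mean P (fun w => expR (t * x n * Z n w)) <=
      expR (x n * (t ^+ 2 / 2 + e ^+ 2 / 8)) by near: n; exact: mgf.
  have /andP[_ Mp] : expR (x n * ((t + e) ^+ 2 / 2 - e ^+ 2 / 8)) <=
      mean P (fun w => expR ((t + e) * x n * Z n w)) <=
      expR (x n * ((t + e) ^+ 2 / 2 + e ^+ 2 / 8)) by near: n; exact: mgf.
  have /andP[_ Mm] : expR (x n * ((t - e) ^+ 2 / 2 - e ^+ 2 / 8)) <=
      mean P (fun w => expR ((t - e) * x n * Z n w)) <=
      expR (x n * ((t - e) ^+ 2 / 2 + e ^+ 2 / 8)) by near: n; exact: mgf.
  apply: le_trans (gaussian_ball_ge (bZ n) (x0 n n0) (mZB n) e_gt0 _ _ Mt Mp Mm).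
  + rewrite ler_pdivlMr//.
    apply: (@le_trans _ _ (expR (x n * (- (t ^+ 2 / 2) - eta)) * expR (x n * e))).
      rewrite ler_wpM2l ?expR_ge0//; apply: le_trans (expR_ge1Dx _); lra.
    rewrite -expRD ler_expR -mulrDr -[- (x n * _)]mulrN ler_wpM2l//; first exact/ltW/x0.
    have : e ^+ 2 <= e by rewrite expr2 ger_pMr.
    lra.
  + by move=> w we; apply: e0B; rewrite /ball/= distrC (lt_le_trans we).
  + by apply: le_trans (expR_ge1Dx _); lra.
rewrite leeNr.
have key (r : R) : (r%:E < ereal_inf [set (t ^+ 2 / 2)%:E | t in closure B] ->
    r%:E <= - limn_esup u)%E.
  move=> rm; rewrite leeNr; apply/lee_addgt0Pr => eta eta0.
  have eta2 : 0 < eta / 2 by lra.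
  apply: limn_esup_le_near; near=> n.
  have n0 : (0 < n)%N by near: n; exists 1%N.
  rewrite uE -EFinD; apply: scaled_lne_le; first exact: x0.
  have [r0|r0] := ltP r 0.
    apply: (@le_trans _ _ 1).
      by rewrite -lee_fin fineK ?fin_num_measure// probability_le1.
    rewrite -expR0 ler_expR mulr_ge0 ?(ltW (x0 _ n0))//; lra.
  pose t := Num.sqrt (2 * r).
  have t2 : t ^+ 2 / 2 = r by rewrite sqr_sqrtr ?mulr_ge0//; field.
  have /andP[_ Mt] : expR (x n * (t ^+ 2 / 2 - eta / 2)) <=
      mean P (fun w => expR (t * x n * Z n w)) <=
      expR (x n * (t ^+ 2 / 2 + eta / 2)) by near: n; exact: mgf.
  have /andP[_ MNt] : expR (x n * ((- t) ^+ 2 / 2 - eta / 2)) <=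
      mean P (fun w => expR ((- t) * x n * Z n w)) <=
      expR (x n * ((- t) ^+ 2 / 2 + eta / 2)) by near: n; exact: mgf.
  rewrite sqrrN in MNt.
  apply: (le_trans (gaussian_tail_le (bZ n) (x0 n n0) (mZB n) (sqrtr_ge0 _) _ Mt MNt)).
    move=> w /= BZ; rewrite -[`|_|]ger0_norm// -sqrtr_sqr real_normK ?num_real//.
    rewrite ler_wsqrtr//.
    have : (r%:E < (Z n w ^+ 2 / 2)%:E)%E.
      apply: (lt_le_trans rm); apply: ereal_inf_lbound; exists (Z n w) => //.
      exact: subset_closure.
    by rewrite lte_fin; lra.
  rewrite t2.
  have xe : 2 <= expR (x n * (eta / 2)).
    apply: le_trans (expR_ge1Dx _); rewrite -lerBlDl -ler_pdivrMr//.
    by near: n; exact: x_ge.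
  apply: (le_trans (ler_wpM2r (expR_ge0 _) xe)).
  by rewrite -expRD ler_expR; lra.
case E : (ereal_inf _) => [m| |].
- apply/lee_subgt0Pr => eta eta0; rewrite -EFinB; apply: key.
  by rewrite E lte_fin; lra.
- rewrite leye_eq; apply/eqP/eqyP => r _; apply: key.
  by rewrite E ltry.
- by rewrite leNye.
Unshelve. all: by end_near. Qed.

End GaussianLargeDeviations.

Section CosineMean.
Context (d : measure_display) (T : measurableType d) (R : realType)
  (P : probability T R) (U : {RV P >-> R}).
Hypothesis U_uniform : forall A : set R, measurable A ->
  distribution P U A = uniform_prob (@ltr01 R) A.

Lemma bounded_rv_cos (s : R) : bounded_rv (fun w => cos (s * U w)).
Proof.
split.
  apply: measurableT_comp.
    by apply: continuous_measurable_fun; exact: continuous_cos.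
  exact: measurable_funM.
by exists 1 => w; rewrite ler_norml cos_geN1 cos_le1.
Qed.

Lemma sin_2pi_nat (k : nat) : sin (2 * pi * k%:R) = 0 :> R.
Proof.
elim: k => [|k IH]; first by rewrite mulr0 sin0.
have -> : 2 * pi * k.+1%:R = 2 * pi * k%:R + pi *+ 2 :> R.
  by rewrite -[k.+1%:R]natr1 mulrDr mulr1 [2 * pi]mulr_natl.
by rewrite sinD2pi.
Qed.

Lemma mean_cos (k : nat) :
  mean P (fun w => cos (2 * pi * k%:R * U w)) = (k == 0)%:R.
Proof.
have [->|k0] := eqVneq k 0%N.
  rewrite -[RHS](mean_cst P 1); congr mean; apply/funext => w.
  by rewrite mulr0 mul0r cos0.
pose s : R := 2 * pi * k%:R.
have s0 : s != 0.
  by rewrite !mulf_neq0 ?pnatr_eq0//; apply/lt0r_neq0/pi_gt0.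
suff : mean P (fun w => 1 + cos (s * U w)) = 1.
  rewrite meanD ?mean_cst; [|exact: bounded_rv_cst|exact: bounded_rv_cos].
  by rewrite -/s mulr0n; lra.
pose g (x : R) := (1 + cos (s * x))%:E.
have cg : continuous (fun x : R => 1 + cos (s * x)).
  move=> x; apply: cvgD; first exact: cvg_cst.
  apply: continuous_comp; last exact: continuous_cos.
  by apply: cvgM; [exact: cvg_cst|exact: cvg_id].
have mg : measurable_fun (setT : set (measurableTypeR R)) g.
  by apply/measurable_EFinP; exact: continuous_measurable_fun.
have g0 x : (0 <= g x)%E by rewrite lee_fin; have := cos_geN1 (s * x); lra.
have mU : measurable_fun setT (U : T -> measurableTypeR R).
  exact: (@measurable_funPT _ _ _ _ U).
pose V : {RV P >-> measurableTypeR R} :=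
  HB.pack (U : T -> measurableTypeR R) (isMeasurableFun.Build _ _ _ _ _ mU).
have eqI : (\int[distribution P V]_y g y = \int[uniform_prob (@ltr01 R)]_y g y)%E.
  by apply: eq_measure_integral => A mA _; exact: U_uniform.
rewrite /mean unlock.
transitivity (fine (\int[uniform_prob (@ltr01 R)]_y g y)%E).
  by congr fine; rewrite -eqI (ge0_integral_distribution V mg g0).
rewrite integral_uniform// subr0 invr1 mul1e.
pose G (x : R) := x + s^-1 * sin (s * x).
have dG (x : R) : is_derive x 1 G (1 + cos (s * x)).
  rewrite /G; apply: is_derive_eq.
  by rewrite /GRing.scale /= mulr1 mulrCA mulVf// mulr1.
rewrite (@continuous_FTC2 _ _ G)//.
- by rewrite /G /s !mulr1 sin_2pi_nat !mulr0 sin0 !mulr0 !addr0 sube0.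
- exact: continuous_subspaceT.
- split.
  + by move=> x _; have [] := dG x.
  + apply: cvg_at_right_filter; apply: differentiable_continuous.
    by apply/derivable1_diffP; have [] := dG 0.
  + apply: cvg_at_left_filter; apply: differentiable_continuous.
    by apply/derivable1_diffP; have [] := dG 1.
- by move=> x _; rewrite derive1E; apply: derive_val.
Qed.

End CosineMean.

Section CosinePolynomials.
Context {R : realType}.
Implicit Types (g h : R -> R) (K N : nat).

Inductive cosine_poly N : (R -> R) -> Prop :=
| cosine_poly0 : cosine_poly N (fun=> 0)
| cosine_poly_cons r k g : (k <= N)%N -> cosine_poly N g ->
    cosine_poly N (fun x => r * cos (2 * pi * k%:R * x) + g x).

Lemma cosine_poly_widen N K g :
  (N <= K)%N -> cosine_poly N g -> cosine_poly K g.
Proof.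
move=> NK; elim=> [|r k h kN _ IH]; first exact: cosine_poly0.
by apply: cosine_poly_cons IH; exact: leq_trans NK.
Qed.

Lemma cosine_polyD N g h : cosine_poly N g -> cosine_poly N h ->
  cosine_poly N (fun x => g x + h x).
Proof.
move=> cg ch; elim: cg => [|r k g' kN _ IH].
  by rewrite (_ : (fun x => _) = h)//; apply/funext => x; rewrite add0r.
have := cosine_poly_cons r kN IH.
by congr (cosine_poly N _); apply/funext => x; ring.
Qed.

Lemma cosine_polyZ N r g :
  cosine_poly N g -> cosine_poly N (fun x => r * g x).
Proof.
elim=> [|s k g' kN _ IH].
  rewrite (_ : (fun x => _) = fun=> 0); first exact: cosine_poly0.
  by apply/funext => x; rewrite mulr0.
have := cosine_poly_cons (r * s) kN IH.
by congr (cosine_poly N _); apply/funext => x; ring.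
Qed.

Lemma cosine_poly_cos N k :
  (k <= N)%N -> cosine_poly N (fun x => cos (2 * pi * k%:R * x)).
Proof.
move=> kN; have := cosine_poly_cons 1 kN (cosine_poly0 N).
by congr (cosine_poly N _); apply/funext => x; rewrite mul1r addr0.
Qed.

Lemma cosine_poly_cst N r : cosine_poly N (fun=> r).
Proof.
have := cosine_polyZ r (cosine_poly_cos (leq0n N)).
by congr (cosine_poly N _); apply/funext => x; rewrite mulr0 mul0r cos0 mulr1.
Qed.

Lemma cosine_poly_sum N (I : eqType) (s : seq I) (F : I -> R -> R) :
  (forall i, i \in s -> cosine_poly N (F i)) ->
  cosine_poly N (fun x => \sum_(i <- s) F i x).
Proof.
elim: s => [|i s IH] cF.
  rewrite (_ : (fun x => _) = fun=> 0); first exact: cosine_poly0.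
  by apply/funext => x; rewrite big_nil.
rewrite (_ : (fun x => _) = (fun x => F i x + \sum_(j <- s) F j x)).
  apply: cosine_polyD; first by apply: cF; rewrite mem_head.
  by apply: IH => j js; apply: cF; rewrite inE js orbT.
by apply/funext => x; rewrite big_cons.
Qed.

Lemma cos_natM (k l : nat) (x : R) :
  cos (2 * pi * k%:R * x) * cos (2 * pi * l%:R * x) =
  2^-1 * cos (2 * pi * (k + l)%:R * x) +
  2^-1 * cos (2 * pi * ((k - l) + (l - k))%:R * x).
Proof.
have main (i j : nat) : (j <= i)%N ->
    cos (2 * pi * i%:R * x) * cos (2 * pi * j%:R * x) =
    2^-1 * cos (2 * pi * (i + j)%:R * x) + 2^-1 * cos (2 * pi * (i - j)%:R * x).
  move=> ji.
  have -> : 2 * pi * (i + j)%:R * x = 2 * pi * i%:R * x + 2 * pi * j%:R * x.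
    by rewrite natrD; ring.
  have -> : 2 * pi * (i - j)%:R * x = 2 * pi * i%:R * x - 2 * pi * j%:R * x.
    by rewrite natrB//; ring.
  by rewrite cosD cosB; field.
have [kl|/ltnW lk] := leqP k l.
  by rewrite mulrC main// (eqP kl) add0n addnC.
by rewrite main// (eqP lk) addn0.
Qed.

Lemma cosine_polyM N K g h : cosine_poly N g -> cosine_poly K h ->
  cosine_poly (N + K) (fun x => g x * h x).
Proof.
move=> cg ch; elim: cg => [|r k g' kN _ IHg].
  rewrite (_ : (fun x => _) = fun=> 0); first exact: cosine_poly0.
  by apply/funext => x; rewrite mul0r.
have ckh : cosine_poly (N + K) (fun x => cos (2 * pi * k%:R * x) * h x).
  elim: ch {IHg} => [|s l h' lK _ IHh].
    rewrite (_ : (fun x => _) = fun=> 0); first exact: cosine_poly0.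
    by apply/funext => x; rewrite mulr0.
  have klNK : (k + l <= N + K)%N by exact: leq_add.
  have dNK : ((k - l) + (l - k) <= N + K)%N.
    by apply: leq_trans klNK; rewrite leq_add ?leq_subr.
  have := cosine_polyD (cosine_polyZ (s * 2^-1)
    (cosine_polyD (cosine_poly_cos klNK) (cosine_poly_cos dNK))) IHh.
  congr (cosine_poly _ _); apply/funext => x.
  by rewrite [in RHS]mulrDr [in RHS]mulrCA cos_natM; ring.
have := cosine_polyD (cosine_polyZ r ckh) IHg.
by congr (cosine_poly _ _); apply/funext => x; ring.
Qed.

Lemma cosine_poly_dilate N m g :
  cosine_poly N g -> cosine_poly (N * m) (fun x => g (m%:R * x)).
Proof.
elim=> [|r k g' kN _ IH]; first exact: cosine_poly0.
have kmNm : (k * m <= N * m)%N by rewrite leq_mul2r kN orbT.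
have := cosine_poly_cons r kmNm IH.
by congr (cosine_poly _ _); apply/funext => x; rewrite natrM !mulrA.
Qed.

Lemma cosine_poly_prod K (a : nat -> nat) g n : cosine_poly K g ->
  cosine_poly (K * \sum_(1 <= i < n.+1) a i)
    (fun x => \prod_(1 <= i < n.+1) g ((a i)%:R * x)).
Proof.
move=> cg; elim: n => [|n IH].
  rewrite (_ : (fun x => _) = fun=> 1); first exact: cosine_poly_cst.
  by apply/funext => x; rewrite big_nil.
rewrite big_nat_recr//= mulnDr.
have := cosine_polyM IH (cosine_poly_dilate (a n.+1) cg).
by congr (cosine_poly _ _); apply/funext => x; rewrite [in RHS]big_nat_recr.
Qed.

Lemma cosine_poly_lacunary_sum K (a : nat -> nat) g n : cosine_poly K g ->
  cosine_poly (K * \sum_(1 <= i < n.+1) a i)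
    (fun x => \sum_(1 <= i < n.+1) g ((a i)%:R * x)).
Proof.
move=> cg; apply: cosine_poly_sum => i; rewrite mem_index_iota => /andP[i1 iN].
apply: cosine_poly_widen (cosine_poly_dilate (a i) cg).
rewrite leq_mul2l; apply/orP; right.
by rewrite (big_rem i) ?mem_index_iota ?i1//= leq_addr.
Qed.

End CosinePolynomials.

Section CosinePolynomialMean.
Context (d : measure_display) (T : measurableType d) (R : realType)
  (P : probability T R) (U : {RV P >-> R}).
Hypothesis U_uniform : forall A : set R, measurable A ->
  distribution P U A = uniform_prob (@ltr01 R) A.

Lemma bounded_rv_cosine_poly N (g : R -> R) :
  cosine_poly N g -> bounded_rv (fun w => g (U w)).
Proof.
elim=> [|r k h _ _ IH]; first exact: bounded_rv_cst.
by apply: bounded_rvD => //; apply: bounded_rvZ; exact: bounded_rv_cos.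
Qed.

Lemma cosine_poly_bounded N (g : R -> R) :
  cosine_poly N g -> exists2 M : R, 0 <= M & forall x, `|g x| <= M.
Proof.
elim=> [|r k h _ _ [M M0 hM]]; first by exists 0 => // x; rewrite normr0.
exists (`|r| + M); first by rewrite addr_ge0.
move=> x; rewrite (le_trans (ler_normD _ _))// lerD// normrM ler_piMr//.
by rewrite ler_norml cos_geN1 cos_le1.
Qed.

(* No frequency below [m] of [h] is cancelled by a nonzero frequency, a
   multiple of [m], of [x |-> g (m x)]. *)
Lemma mean_cosine_polyM N K m (h g : R -> R) :
  cosine_poly N h -> (N < m)%N -> cosine_poly K g ->
  mean P (fun w => h (U w) * g (m%:R * U w)) =
  mean P (fun w => h (U w)) * mean P (fun w => g (U w)).
Proof.
move=> ch Nm cg.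
have bgm (g' : R -> R) : cosine_poly K g' -> bounded_rv (fun w => g' (m%:R * U w)).
  by move=> /(cosine_poly_dilate m)/bounded_rv_cosine_poly.
elim: ch => [|r k h' kN ch' IH].
  rewrite (_ : (fun w => _) = fun=> 0); last by apply/funext => w; rewrite mul0r.
  by rewrite !mean_cst mul0r.
have bk j : bounded_rv (fun w => cos (2 * pi * j%:R * U w)) by exact: bounded_rv_cos.
have kg : mean P (fun w => cos (2 * pi * k%:R * U w) * g (m%:R * U w)) =
    mean P (fun w => cos (2 * pi * k%:R * U w)) * mean P (fun w => g (U w)).
  elim: cg => [|s l g' lK cg' IHg].
    rewrite (_ : (fun w => _) = fun=> 0); last by apply/funext => w; rewrite mulr0.
    by rewrite !mean_cst mulr0.
  have bg' := bounded_rv_cosine_poly cg'.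
  rewrite meanD ?meanZ//; last exact: bounded_rvZ.
  rewrite [RHS]mulrDr -IHg.
  transitivity (mean P (fun w => s * (2^-1 * cos (2 * pi * (k + l * m)%:R * U w) +
      2^-1 * cos (2 * pi * ((k - l * m) + (l * m - k))%:R * U w)) +
      cos (2 * pi * k%:R * U w) * g' (m%:R * U w))).
    congr mean; apply/funext => w; rewrite -cos_natM natrM !mulrA; ring.
  rewrite meanD; last 2 first.
  - by do 3?[apply: bounded_rvZ || apply: bounded_rvD].
  - by apply: bounded_rvM => //; exact: bgm.
  rewrite meanZ; last by apply: bounded_rvD; exact: bounded_rvZ.
  rewrite meanD ?meanZ//; [|exact: bounded_rvZ|exact: bounded_rvZ].
  rewrite !mean_cos//; congr (_ + _).
  rewrite addn_eq0 addn_eq0 !subn_eq0 muln_eq0.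
  have /negbTE m0 : m != 0%N by rewrite -lt0n (leq_ltn_trans _ Nm).
  rewrite m0 orbF; have [->|k0] := eqVneq k 0%N.
    by rewrite leq0n/= leqn0 muln_eq0 m0 orbF; case: (l == 0%N) => /=; field.
  have [->|l0] := eqVneq l 0%N.
    by rewrite mul0n leqn0 (negbTE k0)/=; ring.
  rewrite /= [(l * m <= k)%N]leqNgt (leq_trans (leq_ltn_trans kN Nm)) ?leq_pmull ?lt0n//.
  by rewrite /= andbF /=; ring.
have bh' := bounded_rv_cosine_poly ch'.
rewrite meanD ?meanZ//; last exact: bounded_rvZ.
rewrite [RHS]mulrDl -IH -[r * _ * _]mulrA -kg -meanZ; last first.
  by apply: bounded_rvM => //; exact: bgm.
rewrite -meanD; last 2 first.
- by apply: bounded_rvZ; apply: bounded_rvM => //; exact: bgm.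
- by apply: bounded_rvM => //; exact: bgm.
by congr mean; apply/funext => w; ring.
Qed.

Lemma mean_cosine_poly_dilate K m (g : R -> R) : (0 < m)%N ->
  cosine_poly K g -> mean P (fun w => g (m%:R * U w)) = mean P (fun w => g (U w)).
Proof.
move=> m0 cg; have := mean_cosine_polyM (cosine_poly_cst 0 1) m0 cg.
rewrite mean_cst mul1r => <-.
by congr mean; apply/funext => w; rewrite mul1r.
Qed.

End CosinePolynomialMean.

Section QuadraticTaylor.
Context {R : realType}.

(* The derivative of [exp(-s) (1 + s + s^2 / 2)] is [- exp(-s) s^2 / 2]. *)
Lemma expR_quadratic_dist (s : R) : `|s| <= 2^-1 ->
  `|expR (- s) * (1 + s + s ^+ 2 / 2) - 1| <= `|s| ^+ 3.
Proof.
move=> s2.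
pose w (x : R) := expR (- x) * (1 + x + x ^+ 2 / 2).
have dw (x : R) : is_derive x 1 w (- (expR (- x) * x ^+ 2 / 2)).
  rewrite /w; apply: is_derive_eq.
  by rewrite /GRing.scale /=; field.
have cw (A : set R) : {within A, continuous w}.
  apply: continuous_subspaceT => y; apply: differentiable_continuous.
  by apply/derivable1_diffP; have [] := dw y.
have w0 : w 0 = 1 by rewrite /w oppr0 expR0 expr0n /= mul0r !addr0 mul1r.
have [c cs] : exists2 c, `|c| <= `|s| &
    w s - w 0 = - (expR (- c) * c ^+ 2 / 2) * s.
  have [s0|s0] := leP 0 s.
    have [c] := MVT_segment s0 (fun x _ => dw x) (cw _).
    rewrite in_itv/= => /andP[c0 cs]; rewrite subr0 => ws; exists c => //.
    by rewrite !ger0_norm.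
  have [c] := MVT_segment (ltW s0) (fun x _ => dw x) (cw _).
  rewrite in_itv/= => /andP[sc c0]; rewrite sub0r => ws; exists c => //.
    by rewrite !ler0_norm ?lerN2// ltW.
  by rewrite -opprB ws; ring.
rewrite w0 /w => ->.
have c2 : `|c| <= 2^-1 by exact: le_trans s2.
have e2 : expR (- c) <= 2.
  rewrite expRN -[leRHS]invrK lef_pV2 ?posrE ?expR_gt0 ?invr_gt0//.
  apply: le_trans (expR_ge1Dx _); move: c2; rewrite ler_norml => /andP[+ _]; lra.
rewrite normrM normrN (ger0_norm (_ : 0 <= expR (- c) * c ^+ 2 / 2)); last first.
  by rewrite divr_ge0// mulr_ge0 ?expR_ge0 ?sqr_ge0.
rewrite [leRHS]exprSr ler_wpM2r//.
have : c ^+ 2 <= `|s| ^+ 2 by rewrite -real_normK ?num_real// lerXn2r// nnegrE.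
by have := sqr_ge0 c; nra.
Qed.

Lemma quadratic_le_expR (s : R) : `|s| <= 2^-1 ->
  1 + s + s ^+ 2 / 2 <= expR s * expR (2 * `|s| ^+ 3).
Proof.
move=> s2; have := expR_quadratic_dist s2.
rewrite ler_distl => /andP[_].
rewrite expRN ler_pdivrMl ?expR_gt0// => /le_trans; apply.
rewrite ler_wpM2l ?expR_ge0//; apply: le_trans (expR_ge1Dx _).
by have := exprn_ge0 3 (normr_ge0 s); lra.
Qed.

Lemma expR_le_quadratic (s : R) : `|s| <= 2^-1 ->
  expR s <= (1 + s + s ^+ 2 / 2) * expR (2 * `|s| ^+ 3).
Proof.
move=> s2; have := expR_quadratic_dist s2.
set u := `|s| ^+ 3; have u0 : 0 <= u by exact: exprn_ge0.
have u2 : u <= 2^-1.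
  rewrite /u; apply: (@le_trans _ _ (2^-1 ^+ 3)); last by lra.
  by rewrite lerXn2r// nnegrE.
rewrite ler_distl => /andP[+ _].
rewrite expRN ler_pdivlMl ?expR_gt0// => pu.
apply: (@le_trans _ _ (expR s * (1 - u) * expR (2 * u))); last first.
  by rewrite ler_wpM2r ?expR_ge0.
rewrite -mulrA ler_peMr ?expR_ge0//.
apply: (@le_trans _ _ ((1 - u) * (1 + 2 * u))); first by nra.
by rewrite ler_wpM2l ?expR_ge1Dx//; lra.
Qed.

Lemma expR_le_1D (v : R) : 0 <= v -> expR (v - v ^+ 2) <= 1 + v.
Proof.
move=> v0; rewrite -opprB expRN -[leRHS]invrK lef_pV2 ?posrE ?invr_gt0 ?expR_gt0//; last lra.
apply: le_trans (expR_ge1Dx _); rewrite -div1r ler_pdivrMr; last lra.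
by have := exprn_ge0 3 v0; rewrite !exprS expr0; lra.
Qed.

End QuadraticTaylor.

Lemma lacunary_gap (R : realType) (a : nat -> nat) (K : nat) :
  (forall n, (0 < n)%N -> (0 < a n)%N) ->
  ((a n.+1)%:R / (a n)%:R : R) @[n --> \oo] --> +oo ->
  exists N, forall n, (N <= n)%N -> (K * \sum_(1 <= i < n.+1) a i < a n.+1)%N.
Proof.
move=> a0 /cvgryPge/(_ (2 * K + 2)%:R)[m _ am].
pose M := m.+1.
have growth n : (M <= n)%N -> ((2 * K + 2) * a n <= a n.+1)%N.
  move=> Mn; rewrite -(ler_nat R) natrM -ler_pdivlMr.
    by apply: am => /=; exact: ltnW.
  by rewrite ltr0n a0// (leq_trans _ Mn).
pose s n := (\sum_(1 <= i < n.+1) a i)%N.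
have sS n : (s n.+1 = s n + a n.+1)%N by rewrite /s big_nat_recr.
have s_le k : (s (M + k) <= s M + 2 * a (M + k))%N.
  elim: k => [|k IH]; first by rewrite addn0 leq_addr.
  rewrite addnS sS; have := growth _ (leq_addr k M); nia.
have a_ge k : (k <= a (M + k))%N.
  elim: k => [//|k IH]; rewrite addnS.
  have := growth _ (leq_addr k M); have := a0 (M + k)%N isT; nia.
exists (M + K * s M)%N => n Mn.
have {Mn}[k kK ->] : exists2 k, (K * s M <= k)%N & n = (M + k)%N.
  by exists (n - M)%N; lia.
rewrite -/(s (M + k)%N).
have := s_le k; have := a_ge k; have := growth _ (leq_addr k M).
have := a0 (M + k)%N isT; move: (s (M + k)%N) (a (M + k)%N) (a (M + k).+1) => S A B.
move=> A0 AB kA SA.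
have : (K * S <= K * (s M + 2 * A))%N by rewrite leq_mul2l SA orbT.
by rewrite mulnDr; nia.
Qed.

Section LacunarySums.
Context (d : measure_display) (T : measurableType d) (R : realType)
  (P : probability T R) (U : {RV P >-> R}).
Hypothesis U_uniform : forall A : set R, measurable A ->
  distribution P U A = uniform_prob (@ltr01 R) A.
Variable a : nat -> nat.
Hypothesis a_gt0 : forall n : nat, (0 < n)%N -> (0 < a n)%N.
Hypothesis a_gap : ((a n.+1)%:R / (a n)%:R : R) @[n --> \oo] --> +oo.

Let S (g : R -> R) n (w : T) : R := \sum_(1 <= j < n.+1) g ((a j)%:R * U w).

Lemma bounded_rv_lacunary_sum K (g : R -> R) n :
  cosine_poly K g -> bounded_rv (S g n).
Proof.
by move=> /(cosine_poly_lacunary_sum a n) cS; exact: (bounded_rv_cosine_poly U cS).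
Qed.

Lemma mean_lacunary_prod K : exists N, forall (g : R -> R) n,
  cosine_poly K g -> (N <= n)%N ->
    mean P (fun w => \prod_(1 <= j < n.+1) g ((a j)%:R * U w)) =
    mean P (fun w => \prod_(1 <= j < N.+1) g ((a j)%:R * U w)) *
    mean P (fun w => g (U w)) ^+ (n - N).
Proof.
have [N gap] := lacunary_gap K a_gt0 a_gap.
exists N => g n cg /subnKC <-; rewrite addKn.
elim: (n - N)%N => [|k IH]; first by rewrite addn0 expr0 mulr1.
rewrite addnS exprSr mulrA -IH.
rewrite -(mean_cosine_polyM U_uniform (cosine_poly_prod a (N + k) cg)
  (gap _ (leq_addr k N)) cg).
by congr mean; apply/funext => w; rewrite big_nat_recr.
Qed.

Lemma mean_lacunary_sum_sqr K (f : R -> R) : cosine_poly K f ->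
  mean P (fun w => f (U w)) = 0 ->
  exists C, \forall n \near \oo, mean P (fun w => S f n w ^+ 2) =
    n%:R * mean P (fun w => f (U w) ^+ 2) + C.
Proof.
move=> cf f0; have [N gap] := lacunary_gap K a_gt0 a_gap.
set v := mean P (fun w => f (U w) ^+ 2).
exists (mean P (fun w => S f N w ^+ 2) - N%:R * v), N => // n /= /subnKC <-.
elim: (n - N)%N => [|k IH]; first by rewrite addn0; ring.
have bS m := bounded_rv_lacunary_sum m cf.
have bf : bounded_rv (fun w => f ((a (N + k).+1)%:R * U w)).
  exact: (bounded_rv_cosine_poly U (cosine_poly_dilate _ cf)).
rewrite addnS; transitivity (mean P (fun w => S f (N + k) w ^+ 2 +
    (2 * (S f (N + k) w * f ((a (N + k).+1)%:R * U w)) +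
     f ((a (N + k).+1)%:R * U w) * f ((a (N + k).+1)%:R * U w)))).
  by congr mean; apply/funext => w; rewrite /S big_nat_recr//=; ring.
rewrite meanD; [|exact: bounded_rvM|]; last first.
  by apply: bounded_rvD; [apply: bounded_rvZ|]; exact: bounded_rvM.
rewrite meanD; [|by apply: bounded_rvZ; exact: bounded_rvM|exact: bounded_rvM].
rewrite meanZ; last exact: bounded_rvM.
rewrite IH (mean_cosine_polyM U_uniform (cosine_poly_lacunary_sum a (N + k) cf)
  (gap _ (leq_addr k N)) cf) f0.
rewrite (mean_cosine_poly_dilate U_uniform (a_gt0 (ltn0Sn _)) (cosine_polyM cf cf)).
by rewrite -/v -[(N + k).+1%:R]natr1; ring.
Qed.

Lemma lacunary_mgf K (f : R -> R) M (v := mean P (fun w => f (U w) ^+ 2)) :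
  cosine_poly K f -> mean P (fun w => f (U w)) = 0 ->
  (forall x, `|f x| <= M) ->
  exists N, forall n lam, (N <= n)%N -> `|lam| * M <= 2^-1 ->
    let u := lam ^+ 2 * v / 2 in
    let r := n%:R * u ^+ 2 + 2 * n%:R * (`|lam| * M) ^+ 3 + N%:R * (1 + u) in
    expR (n%:R * u - r) <= mean P (fun w => expR (lam * S f n w))
      <= expR (n%:R * u + r).
Proof.
move=> cf f0 fM; have [N prodN] := mean_lacunary_prod (K + K).
exists N => n lam Nn lamM; cbv zeta.
set u := lam ^+ 2 * v / 2; set r := n%:R * u ^+ 2 + _ + _.
pose g x := 1 + lam * f x + (lam * f x) ^+ 2 / 2.
have cg : cosine_poly (K + K) g.
  have := cosine_polyD (cosine_polyD (cosine_poly_cst (K + K) 1)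
    (cosine_polyZ lam (cosine_poly_widen (leq_addr K K) cf)))
    (cosine_polyZ (lam ^+ 2 / 2) (cosine_polyM cf cf)).
  by congr (cosine_poly _ _); apply/funext => x; rewrite /g; ring.
have bf := bounded_rv_cosine_poly U cf.
have mg : mean P (fun w => g (U w)) = 1 + u.
  transitivity (mean P (fun w => 1 + (lam * f (U w) +
      lam ^+ 2 / 2 * (f (U w) * f (U w))))).
    by congr mean; apply/funext => w; rewrite /g; ring.
  have b2 := bounded_rvZ (lam ^+ 2 / 2) (bounded_rvM bf bf).
  have b1 := bounded_rvZ lam bf.
  rewrite meanD; [|exact: bounded_rv_cst|exact: bounded_rvD].
  rewrite meanD// !meanZ//; last exact: bounded_rvM.
  by rewrite mean_cst f0 /u /v; ring.
have u0 : 0 <= u.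
  rewrite /u divr_ge0// mulr_ge0 ?sqr_ge0// -[0](mean_cst P 0).
  apply: mean_le => //; [exact: bounded_rv_cst|exact: bounded_rvM|].
  by move=> w; exact: sqr_ge0.
have M0 : 0 <= M by exact: le_trans (fM 0).
pose e := 2 * (`|lam| * M) ^+ 3.
have lf x : `|lam * f x| <= `|lam| * M by rewrite normrM ler_wpM2l.
have lf2 x : `|lam * f x| <= 2^-1 by exact: le_trans lamM.
have expRe x : expR (2 * `|lam * f x| ^+ 3) <= expR e.
  by rewrite ler_expR ler_wpM2l// lerXn2r// nnegrE// mulr_ge0.
have g_gt0 x : expR (- 1) <= g x.
  apply: (@le_trans _ _ 2^-1).
    rewrite expRN lef_pV2 ?posrE ?expR_gt0//.
    by apply: le_trans (expR_ge1Dx _); lra.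
  rewrite /g; have := lf2 x; rewrite ler_norml => /andP[+ _].
  by have := sqr_ge0 (lam * f x); lra.
have g_le x : g x <= expR 1.
  apply: (@le_trans _ _ 2); last by apply: le_trans (expR_ge1Dx _); lra.
  by rewrite /g; have := lf2 x; rewrite ler_norml => /andP[]; nra.
have g_ge0 x : 0 <= g x by exact: le_trans (expR_ge0 _) (g_gt0 x).
have gexp x : g x <= expR (lam * f x) * expR e.
  by apply: le_trans (quadratic_le_expR (lf2 x)) _; rewrite ler_wpM2l ?expR_ge0.
have expg x : expR (lam * f x) <= g x * expR e.
  exact: le_trans (expR_le_quadratic (lf2 x)) (ler_wpM2l (g_ge0 x) (expRe x)).
have prod_cst m (b : R) (F : nat -> R) :
    \prod_(1 <= j < m.+1) (F j * b) = \prod_(1 <= j < m.+1) F j * b ^+ m.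
  by rewrite big_split/= prodr_const_nat subn1.
pose G m w := \prod_(1 <= j < m.+1) g ((a j)%:R * U w).
have bG m : bounded_rv (G m).
  exact: (bounded_rv_cosine_poly U (cosine_poly_prod a m cg)).
have bE : bounded_rv (fun w => expR (lam * S f n w)).
  by apply: bounded_rv_expR; apply: bounded_rvZ; exact: bounded_rv_lacunary_sum cf.
have ES w : expR (lam * S f n w) = \prod_(1 <= j < n.+1) expR (lam * f ((a j)%:R * U w)).
  by rewrite /S mulr_sumr expR_sum.
have EG : mean P (fun w => expR (lam * S f n w)) <= expR e ^+ n * mean P (G n).
  rewrite -meanZ//; apply: mean_le => //; first exact: bounded_rvZ.
  move=> w; rewrite ES mulrC -prod_cst; apply: ler_prod => j _.
  by rewrite expR_ge0 expg.
have GE : mean P (G n) <= expR e ^+ n * mean P (fun w => expR (lam * S f n w)).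
  rewrite -meanZ//; apply: mean_le => //; first exact: bounded_rvZ.
  move=> w; rewrite ES mulrC -prod_cst; apply: ler_prod => j _.
  by rewrite g_ge0 gexp.
have GN_le : mean P (G N) <= expR N%:R.
  rewrite -[leRHS](mean_cst P); apply: mean_le => //; first exact: bounded_rv_cst.
  move=> w; rewrite -[N%:R]mulr1 expRM_natl.
  have := prod_cst N (expR 1) (fun=> 1).
  rewrite [X in _ = X * _]big1// [RHS]mul1r => <-.
  by apply: ler_prod => j _; rewrite mul1r g_ge0 g_le.
have GN_ge : expR (- N%:R) <= mean P (G N).
  rewrite -[leLHS](mean_cst P); apply: mean_le => //; first exact: bounded_rv_cst.
  move=> w; rewrite -[N%:R]mulr1 -mulrN expRM_natl.
  have := prod_cst N (expR (- 1)) (fun=> 1).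
  rewrite [X in _ = X * _]big1// [RHS]mul1r => <-.
  by apply: ler_prod => j _; rewrite mul1r expR_ge0 g_gt0.
have GnE : mean P (G n) = mean P (G N) * (1 + u) ^+ (n - N).
  by rewrite /G (prodN _ _ cg Nn) mg.
have nN : (n - N)%:R = n%:R - N%:R :> R by rewrite natrB.
have N0 : 0 <= N%:R :> R by [].
have n_ge0 : 0 <= n%:R :> R by [].
have uN : 0 <= N%:R * u by rewrite mulr_ge0.
have uuN : 0 <= N%:R * u ^+ 2 by rewrite mulr_ge0 ?sqr_ge0.
have uun : 0 <= n%:R * u ^+ 2 by rewrite mulr_ge0 ?sqr_ge0.
have en : expR e ^+ n = expR (n%:R * e) by exact/esym/expRM_natl.
apply/andP; split.
- have : expR (n%:R * u - r) * expR (n%:R * e) <= mean P (G n).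
    rewrite GnE; apply: (@le_trans _ _ (expR (- N%:R) * expR (u - u ^+ 2) ^+ (n - N))).
      rewrite -expRM_natl -!expRD ler_expR nN /r /e; lra.
    rewrite ler_pM ?exprn_ge0 ?expR_ge0//.
    by rewrite lerXn2r ?nnegrE ?expR_ge0 ?addr_ge0 ?expR_le_1D.
  move=> /le_trans/(_ GE); rewrite en [leRHS]mulrC ler_pM2r//; exact: expR_gt0.
- apply: (le_trans EG); rewrite GnE en.
  apply: (@le_trans _ _ (expR (n%:R * e) * (expR N%:R * expR u ^+ (n - N)))).
    rewrite ler_wpM2l ?expR_ge0// ler_pM ?exprn_ge0 ?addr_ge0//.
    - exact: le_trans (expR_ge0 _) GN_ge.
    - by rewrite lerXn2r ?nnegrE ?expR_ge0 ?addr_ge0// expR_ge1Dx.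
  rewrite -expRM_natl -!expRD ler_expR nN /r /e; lra.
Qed.

End LacunarySums.

Section TrigPoly.
Context {R : realType}.
Implicit Types (c : int -> R) (D : nat).

Definition cosine_sum D c (t : R) : R :=
  \sum_(k <- symm_range D) c k * cos (2 * pi * k%:~R * t).

Lemma trig_poly_real D c (f : R -> R) :
  (forall t : R, ((f t)%:C)%C = trig_poly D c t) -> f = cosine_sum D c.
Proof.
move=> fE; apply/funext => t.
have [q sE] : exists q, trig_poly D c t = (cosine_sum D c t +i* q)%C.
  rewrite /trig_poly /cosine_sum; elim: (symm_range D) => [|k s [q IH]].
    by exists 0; rewrite !big_nil.
  rewrite !big_cons IH.
  exists (c k * sin (2 * pi * k%:~R * t) + q).
  by apply/eqP; rewrite eq_complex /= !mul0r subr0 addr0 !eqxx.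
by move: (fE t); rewrite sE => -[].
Qed.

Lemma mem_symm_range D (k : int) : (k \in symm_range D) = (`|k| <= D)%N.
Proof.
apply/mapP/idP => [[j]|kD].
  by rewrite mem_iota => jD ->; lia.
exists (absz (k + D%:Z)); last by lia.
by rewrite mem_iota; lia.
Qed.

Lemma uniq_symm_range D : uniq (symm_range D).
Proof.
by rewrite map_inj_uniq ?iota_uniq// => i j; lia.
Qed.

Lemma cos_absz (k : int) (t : R) :
  cos (2 * pi * k%:~R * t) = cos (2 * pi * `|k|%:R * t).
Proof.
case: k => // n; rewrite NegzE abszN absz_nat -cosN; congr cos.
by rewrite mulrNz; ring.
Qed.

Lemma cosine_sum_poly D c : cosine_poly D (cosine_sum D c).
Proof.
apply: cosine_poly_sum => k; rewrite mem_symm_range => kD.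
have := cosine_polyZ (c k) (cosine_poly_cos kD).
by congr (cosine_poly _ _); apply/funext => t; rewrite cos_absz.
Qed.

End TrigPoly.

Section TrigPolyMean.
Context (d : measure_display) (T : measurableType d) (R : realType)
  (P : probability T R) (U : {RV P >-> R}).
Hypothesis U_uniform : forall A : set R, measurable A ->
  distribution P U A = uniform_prob (@ltr01 R) A.
Variables (D : nat) (c : int -> R).

Let mean_cosz (k : int) : mean P (fun w => cos (2 * pi * k%:~R * U w)) = (k == 0)%:R.
Proof.
transitivity (mean P (fun w => cos (2 * pi * `|k|%:R * U w))).
  by congr mean; apply/funext => w; rewrite cos_absz.
by rewrite mean_cos// absz_eq0.
Qed.

Lemma mean_cosine_sum : c 0 = 0 -> mean P (fun w => cosine_sum D c (U w)) = 0.
Proof.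
move=> c0; rewrite /cosine_sum mean_sum; last first.
  by move=> k; apply: bounded_rvZ; exact: bounded_rv_cos.
apply: big1 => k _; rewrite meanZ; last exact: bounded_rv_cos.
by rewrite mean_cosz; have [->|_] := eqVneq k 0; rewrite ?c0 ?mul0r ?mulr0.
Qed.

Lemma mean_cosine_sum_sqr :
  (forall k : int, (`|k| <= D)%N -> c k = c (- k)) ->
  mean P (fun w => cosine_sum D c (U w) ^+ 2) = \sum_(k <- symm_range D) c k ^+ 2.
Proof.
move=> c_sym; pose C (k : int) w := cos (2 * pi * k%:~R * U w).
have bC k : bounded_rv (C k) by exact: bounded_rv_cos.
have pick (k : int) : (`|k| <= D)%N ->
    \sum_(j <- symm_range D) c j * (j == k)%:R = c k.
  move=> kD; rewrite (bigD1_seq k) ?mem_symm_range ?uniq_symm_range//=.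
  by rewrite eqxx mulr1 big1 ?addr0// => j /negbTE ->; rewrite mulr0.
have mC k j : mean P (fun w => C k w * C j w) = 2^-1 * ((j == - k)%:R + (j == k)%:R).
  transitivity (mean P (fun w => 2^-1 * (C (j + k) w + C (j - k) w))).
    congr mean; apply/funext => w; rewrite /C rmorphD rmorphB/=.
    have -> : 2 * pi * (j%:~R + k%:~R) * U w =
        2 * pi * j%:~R * U w + 2 * pi * k%:~R * U w by ring.
    have -> : 2 * pi * (j%:~R - k%:~R) * U w =
        2 * pi * j%:~R * U w - 2 * pi * k%:~R * U w by ring.
    by rewrite cosD cosB; field.
  rewrite meanZ ?meanD//; last exact: bounded_rvD.
  by rewrite !mean_cosz addr_eq0 subr_eq0.
transitivity (mean P (fun w => \sum_(k <- symm_range D) c k *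
    \sum_(j <- symm_range D) c j * (C k w * C j w))).
  congr mean; apply/funext => w; rewrite expr2 /cosine_sum mulr_suml.
  apply: eq_bigr => k _; rewrite -mulrA; congr (_ * _).
  by rewrite mulr_sumr; apply: eq_bigr => j _; rewrite mulrCA.
have bs k : bounded_rv (fun w => \sum_(j <- symm_range D) c j * (C k w * C j w)).
  by apply: bounded_rv_sum => j _; apply: bounded_rvZ; exact: bounded_rvM.
rewrite mean_sum; last by move=> k; exact: bounded_rvZ.
rewrite big_seq [RHS]big_seq; apply: eq_bigr => k; rewrite mem_symm_range => kD.
rewrite meanZ// mean_sum; last by move=> j; apply: bounded_rvZ; exact: bounded_rvM.
rewrite expr2; congr (_ * _).
transitivity (2^-1 * (\sum_(j <- symm_range D) c j * (j == - k)%:R +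
                      \sum_(j <- symm_range D) c j * (j == k)%:R)).
  rewrite -big_split mulr_sumr; apply: eq_bigr => j _ /=.
  by rewrite meanZ; [rewrite mC; ring|exact: bounded_rvM].
by rewrite !pick ?abszN// -c_sym//; field.
Qed.

End TrigPolyMean.

Theorem theorem2 (R : realType) (d : measure_display) (T : measurableType d)
    (P : probability T R) (U : {RV P >-> R})
    (a : nat -> nat) (D : nat) (c : int -> R) (f : R -> R) (z : nat -> R)
    (U_uniform : forall A : set R, measurable A ->
       distribution P U A = uniform_prob (@ltr01 R) A)
    (a_gt0 : forall n : nat, (0 < n)%N -> (0 < a n)%N)
    (a_gap : ((a n.+1)%:R / (a n)%:R : R) @[n --> \oo] --> +oo)
    (c_sym : forall k : int, (`|k| <= D)%N -> c k = c (- k))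
    (c_0 : c 0 = 0)
    (c_neq0 : 0 < \sum_(k <- symm_range D) c k ^+ 2)
    (f_def : forall t : R, ((f t)%:C)%C = trig_poly D c t)
    (z_gt0 : forall n : nat, (0 < n)%N -> 0 < z n)
    (z_cvg0 : z n @[n --> \oo] --> 0)
    (nz_cvg : z n * n%:R @[n --> \oo] --> +oo) :
  let X (j : nat) (w : T) : R := f ((a j)%:R * U w) in
  let EX2 : R := fine ('E_P[fun w => (X 1%N w ^+ 2)%R])%E in
  let x (n : nat) : R := n%:R * z n * EX2 in
  let y (n : nat) : R := n%:R * Num.sqrt (z n) * EX2 in
  ((fun n : nat => fine ('E_P[fun w => (partial_sum X n w ^+ 2)%R])%E : R^o)
     = (fun n : nat => n%:R * EX2 : R^o) +O_\oo (fun _ : nat => 1 : R^o))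
  /\ moderate_deviation_principle P X y x (fun t : R => (t ^+ 2 / 2)%:E).
Proof.
move=> X EX2 x y.
have fE := trig_poly_real f_def.
have cf : cosine_poly D f by rewrite fE; exact: cosine_sum_poly.
have f0 : mean P (fun w => f (U w)) = 0 by rewrite fE; exact: mean_cosine_sum.
have EX2E : EX2 = mean P (fun w => f (U w) ^+ 2).
  have E := mean_cosine_poly_dilate U_uniform (a_gt0 1%N isT) (cosine_polyM cf cf).
  exact: E.
have v0 : 0 < EX2 by rewrite EX2E fE mean_cosine_sum_sqr.
have [M M0 fM] := cosine_poly_bounded cf.
pose q n : R := Num.sqrt (z n).
have q2 n : (0 < n)%N -> q n ^+ 2 = z n by move=> /z_gt0/ltW; exact: sqr_sqrtr.
have q0 n : 0 <= q n by exact: sqrtr_ge0.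
have q_gt0 n : (0 < n)%N -> 0 < q n by move=> /z_gt0; rewrite sqrtr_gt0.
have q_cvg0 : q n @[n --> \oo] --> 0.
  rewrite -[0]sqrtr0; apply: (cvg_comp _ _ z_cvg0); exact: sqrt_continuous.
have q_small (A B : R) : 0 < B -> \forall n \near \oo, q n * A <= B.
  move=> B0; have A1 : 0 < `|A| + 1 by rewrite ltr_wpDl.
  near=> n; have : `|q n| <= B / (`|A| + 1).
    by near: n; apply: cvgr0_norm_le => //; exact: divr_gt0.
  rewrite ger0_norm// ler_pdivlMr//; apply: le_trans.
  by rewrite ler_wpM2l// (le_trans (ler_norm A))// lerDl.
have nz_ge (A : R) : \forall n \near \oo, A <= z n * n%:R.
  by move/cvgryPge : nz_cvg; exact.
have n_gt0 : \forall n \near \oo, (0 < n)%N by exists 1%N.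
split.
  have [C SE] := mean_lacunary_sum_sqr U_uniform a_gt0 a_gap cf f0.
  apply/eqaddOP; near=> k; near=> n.
  rewrite normr1 mulr1 /=.
  have -> : ((fun n => fine 'E_P[fun w => (partial_sum X n w ^+ 2)%R]%E : R^o) -
    (fun n => n%:R * EX2 : R^o)) n = C.
    rewrite !fctE; apply/eqP; rewrite subr_eq addrC EX2E; apply/eqP.
    by near: n.
  by near: k; exact: nbhs_pinfty_ge.
split.
- apply/cvgryPge => A; near=> n.
  have n0 : (0 < n)%N by near: n.
  have q1 : q n * 1 <= 1 by near: n; exact: q_small.
  have nzA : A / EX2 <= z n * n%:R by near: n; exact: nz_ge.
  move: nzA; rewrite ler_pdivrMr// => /le_trans; apply.
  rewrite /y -/(q n) -q2// ler_wpM2r ?(ltW v0)// mulrC ler_wpM2l// expr2 ler_piMr//.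
  by rewrite mulr1 in q1.
- have : q n * EX2 @[n --> \oo] --> 0 * EX2 by exact: cvgMl.
  rewrite mul0r; apply: cvg_trans; apply: near_eq_cvg; near=> n.
  rewrite /y -/(q n) -mulrA mulrAC divff ?mul1r//.
  by rewrite pnatr_eq0 -lt0n; near: n.
- apply/cvgryPge => A; near=> n.
  have n0 : (0 < n)%N by near: n.
  have nzA : (A / EX2) ^+ 2 <= z n * n%:R by near: n; exact: nz_ge.
  have -> : y n / Num.sqrt n%:R = Num.sqrt (z n * n%:R) * EX2.
    rewrite sqrtrM ?(ltW (z_gt0 _ n0))// /y -{1}[n%:R](@sqr_sqrtr R)//.
    by field; rewrite sqrtr_eq0 -ltNge ltr0n.
  rewrite -ler_pdivrMr// (le_trans (ler_norm _))// -sqrtr_sqr ler_wsqrtr//.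
have bS n : bounded_rv (partial_sum X n) by exact: (bounded_rv_lacunary_sum U a n cf).
have xE n : x n = z n * n%:R * EX2 by rewrite /x; ring.
apply: gaussian_gartner_ellis.
- move=> n; rewrite (_ : (fun w => _) = (fun w => (y n)^-1 * partial_sum X n w)).
    exact: bounded_rvZ.
  by apply/funext => w; rewrite mulrC.
- by move=> n n0; rewrite xE !mulr_gt0 ?z_gt0 ?ltr0n.
- by apply/cvgryPge => A; near=> n; rewrite xE -ler_pdivrMr//; near: n; exact: nz_ge.
move=> t e e0.
have half0 : 0 < 2^-1 :> R by lra.
have e40 : 0 < e / 4 by lra.
have [N mgfN] := lacunary_mgf U_uniform a_gt0 a_gap cf f0 fM.
near=> n.
have n0 : (0 < n)%N by near: n.
have q1 : q n * 1 <= 1 by near: n; exact: q_small.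
rewrite mulr1 in q1.
have Nn : (N <= n)%N by near: n; exists N.
have tqM : `|t * q n| * M <= 2^-1.
  rewrite normrM (ger0_norm (q0 n)) -mulrA mulrCA.
  by near: n; exact: (q_small _ _ half0).
have qu : q n * (t ^+ 2 * EX2) <= 2 by near: n; exact: q_small.
have r1 : q n * (t ^+ 4 * EX2) <= e by near: n; exact: q_small.
have r2 : q n * (2 * `|t| ^+ 3 * M ^+ 3 / EX2) <= e / 4.
  by near: n; exact: (q_small _ _ e40).
have r3 : 8 * N%:R / e / EX2 <= z n * n%:R by near: n; exact: nz_ge.
have := mgfN n (t * q n) Nn tqM; cbv zeta.
rewrite -EX2E.
set u := (t * q n) ^+ 2 * EX2 / 2; set r := n%:R * u ^+ 2 + _ + _.
have x_gt0 : 0 < x n by rewrite xE !mulr_gt0 ?z_gt0 ?ltr0n.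
have xq : x n = n%:R * q n ^+ 2 * EX2 by rewrite q2.
have nu : n%:R * u = x n * (t ^+ 2 / 2) by rewrite xq /u; field.
have re : r <= x n * e.
  have q21 : q n ^+ 2 <= q n by rewrite expr2 ler_piMr.
  have u1 : u <= 1.
    rewrite /u ler_pdivrMr// mul1r (le_trans _ qu)// exprMn mulrAC [leRHS]mulrC.
    by rewrite ler_wpM2l// mulr_ge0 ?sqr_ge0 ?ltW.
  have s1 : n%:R * u ^+ 2 <= x n * (e / 4).
    have -> : n%:R * u ^+ 2 = x n * (q n ^+ 2 * (t ^+ 4 * EX2) / 4).
      by rewrite xq /u; field.
    rewrite ler_wpM2l ?(ltW x_gt0)// ler_wpM2r// (le_trans _ r1)// ler_wpM2r//.
    by rewrite mulr_ge0 ?(ltW v0)// (exprM t 2 2) sqr_ge0.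
  have s2 : 2 * n%:R * (`|t * q n| * M) ^+ 3 <= x n * (e / 4).
    have -> : 2 * n%:R * (`|t * q n| * M) ^+ 3 =
        x n * (q n * (2 * `|t| ^+ 3 * M ^+ 3 / EX2)).
      by rewrite xq normrM (ger0_norm (q0 n)); field; exact: lt0r_neq0.
    by rewrite ler_wpM2l ?(ltW x_gt0).
  have s3 : N%:R * (1 + u) <= x n * (e / 4).
    apply: (@le_trans _ _ (N%:R * 2)); first by rewrite ler_wpM2l//; lra.
    by move: r3; rewrite ler_pdivrMr// -xE ler_pdivrMr//; lra.
  by rewrite /r; have := mulr_ge0 (ltW x_gt0) (ltW e0); lra.
have ZE w : t * x n * (partial_sum X n w / y n) = t * q n * partial_sum X n w.
  rewrite xq /y -/(q n); field.
  by rewrite !lt0r_neq0 ?q_gt0 ?ltr0n.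
move=> /andP[lo hi]; under eq_fun do rewrite ZE; apply/andP; split.
- by apply: le_trans lo; rewrite ler_expR nu mulrBr lerB.
- by apply: (le_trans hi); rewrite ler_expR nu mulrDr lerD2l.
Unshelve. all: by end_near. Qed.
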